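(* Let $R$ be a commutative Noetherian ring. The following assertions are equivalent: (i) $R$ is a balanced ring. (ii) $\operatorname{Hom}_R(R/M, R) \neq 0$ for every maximal ideal $M$ of $R$. (iii) $\operatorname{depth}(R_M) = 0$ for every maximal ideal $M$ of $R$.
   Context: Rings have an identity. The total ring of fractions $T(R)$ of a commutative ring $R$ is the localization $S^{-1}R$ where $S$ is the set of all non-zero-divisors of $R$. A commutative ring $R$ is called a balanced ring if the canonical ring map $R \to T(R)$, $r\mapsto r/1$, is an isomorphism. $R_M$ denotes the localization of $R$ at the maximal ideal $M$, and $\operatorname{depth}(R_M)$ is the depth of this Noetherian local ring as a module over itself with respect to its maximal ideal. *)

(* Defs.v *)
From HB Require Import structures.
From mathcomp Require Import all_boot all_order all_algebra.
From mathcomp Require Import boolp classical_sets.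
From mathcomp Require Import ring.

Set Implicit Arguments.
Unset Strict Implicit.
Unset Printing Implicit Defensive.

Import GRing.Theory.
Local Open Scope ring_scope.
Local Open Scope quotient_scope.

(* Commutative rings are [comPzRingType]s, which allow the zero ring.
   Submodules are boolean predicates ([submodClosed V]); an ideal of R is a
   submodule of the regular module R^o.  Since [asbool] turns any proposition
   into a boolean, every submodule is of this form. *)

Definition submod_pred (R : pzRingType) (V : lmodType R) (N : submodClosed V) :
  {pred V} := N.

Section QuotientModule.
Variables (R : pzRingType) (V : lmodType R) (N : submodClosed V).

(* [submodClosed] carries no closure under opposite, which [{quot _}] needs. *)
Lemma submod_pred_zmod_closed : zmod_closed (submod_pred N).
Proof. exact/GRing.submod_closedB/GRing.submodClosedP. Qed.
HB.instance Definition _ :=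
  GRing.isZmodClosed.Build V (submod_pred N) submod_pred_zmod_closed.

Definition quotmod := Quotient.quot (submod_pred N).
HB.instance Definition _ := GRing.Zmodule.on quotmod.

Definition quotmod_pi (v : V) : quotmod := \pi_(Quotient.quot (submod_pred N)) v.

Lemma quotmod_piP v w : reflect (quotmod_pi v = quotmod_pi w) (v - w \in N).
Proof.
have -> : (v - w \in N) = (quotmod_pi v == quotmod_pi w).
  exact: (Quotient.idealrBE (submod_pred N)).
exact: eqP.
Qed.

Lemma quotmod_pi_surj (x : quotmod) : exists v, x = quotmod_pi v.
Proof. by exists (repr x); rewrite /quotmod_pi reprK. Qed.

Lemma quotmod_piD v w : quotmod_pi (v + w) = quotmod_pi v + quotmod_pi w.
Proof. by rewrite /quotmod_pi raddfD. Qed.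

Definition quotmod_scale (a : R) (x : quotmod) : quotmod :=
  quotmod_pi (a *: repr x).

Lemma quotmod_scale_pi a v : quotmod_scale a (quotmod_pi v) = quotmod_pi (a *: v).
Proof.
apply/quotmod_piP; rewrite -scalerBr; apply: rpredZ.
by apply/quotmod_piP; rewrite /quotmod_pi reprK.
Qed.

Fact quotmod_scaleA a b x :
  quotmod_scale a (quotmod_scale b x) = quotmod_scale (a * b) x.
Proof.
by have [v ->] := quotmod_pi_surj x; rewrite !quotmod_scale_pi scalerA.
Qed.

Fact quotmod_scale1 : left_id 1 quotmod_scale.
Proof.
by move=> x; have [v ->] := quotmod_pi_surj x; rewrite quotmod_scale_pi scale1r.
Qed.

Fact quotmod_scaleDr : right_distributive quotmod_scale +%R.
Proof.
move=> a x y; have [v ->] := quotmod_pi_surj x.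
have [w ->] := quotmod_pi_surj y.
by rewrite -quotmod_piD !quotmod_scale_pi scalerDr quotmod_piD.
Qed.

Fact quotmod_scaleDl x : {morph quotmod_scale^~ x : a b / a + b}.
Proof.
move=> a b /=; have [v ->] := quotmod_pi_surj x.
by rewrite !quotmod_scale_pi scalerDl quotmod_piD.
Qed.

HB.instance Definition _ := GRing.Zmodule_isLmodule.Build R quotmod
  quotmod_scaleA quotmod_scale1 quotmod_scaleDr quotmod_scaleDl.

Fact quotmod_pi_linear : linear quotmod_pi.
Proof. by move=> a v w; rewrite quotmod_piD -quotmod_scale_pi. Qed.
HB.instance Definition _ :=
  GRing.isLinear.Build R V quotmod _ quotmod_pi quotmod_pi_linear.

End QuotientModule.

Arguments quotmod {R V} N.
Arguments quotmod_pi {R V} N v.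

Definition finitely_generated (R : pzRingType) (V : lmodType R)
    (N : submodClosed V) : Prop :=
  exists (n : nat) (g : 'I_n -> V),
    forall v : V, v \in N <-> exists c : 'I_n -> R, v = \sum_i c i *: g i.

Definition noetherian (R : comPzRingType) : Prop :=
  forall I : submodClosed R^o, finitely_generated I.

Definition maximal_ideal (R : comPzRingType) (M : submodClosed R^o) : Prop :=
  1 \notin M /\
  forall J : submodClosed R^o, 1 \notin J -> {subset M <= J} -> {subset J <= M}.

Record maxIdeal (R : comPzRingType) := MaxIdeal {
  maxIdeal_val :> submodClosed R^o;
  maxIdealP : maximal_ideal maxIdeal_val
}.

Section Localization.
Variables (R : comPzRingType) (S : mulrClosed R).

Definition denom := {s : R | s \in S}.

Definition denom1 : denom := exist _ 1 (rpred1 S).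
Definition denomM (s t : denom) : denom :=
  exist _ (val s * val t) (rpredM (valP s) (valP t)).

(* The factor u accounts for zero divisors in S. *)
Definition loc_equiv (x y : R * denom) : bool :=
  `[< exists2 u : R, u \in S & u * (val y.2 * x.1 - val x.2 * y.1) = 0 >].

Fact loc_equiv_is_equiv : equiv_class_of loc_equiv.
Proof.
split=> [[a s]|[a s] [b t]|[b t] [a s] [c r]].
- by apply/asboolP; exists 1; rewrite ?rpred1 //= subrr mulr0.
- apply/asboolP/asboolP => -[u Su /= e]; exists u => //=;
    by rewrite -opprB mulrN e oppr0.
- move=> /asboolP [u Su e] /asboolP [w Sw f].
  apply/asboolP; exists (u * w * val t); first by rewrite !rpredM ?(valP t).
  move: (val s) (val t) (val r) e f => /= s' t' r' e f.
  have -> : u * w * t' * (r' * a - s' * c) =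
    w * r' * (u * (t' * a - s' * b)) + u * s' * (w * (r' * b - t' * c)) by ring.
  by rewrite e f !mulr0 addr0.
Qed.

Canonical loc_equiv_rel := EquivRelPack loc_equiv_is_equiv.
Canonical loc_encModRel := defaultEncModRel loc_equiv.

Definition loc := {eq_quot loc_equiv}.
HB.instance Definition _ := Choice.on loc.

Definition loc_frac (a : R) (s : denom) : loc := \pi_{eq_quot loc_equiv} (a, s).

Lemma loc_fracP a s b t :
  loc_frac a s = loc_frac b t <->
  exists2 u : R, u \in S & u * (val t * a - val s * b) = 0.
Proof.
split=> [/eqP|h]; first by rewrite /loc_frac piE => /asboolP.
by apply/eqP; rewrite /loc_frac piE; apply/asboolP.
Qed.

Lemma loc_frac_surj (x : loc) : exists a s, x = loc_frac a s.
Proof.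
by exists (repr x).1, (repr x).2; rewrite /loc_frac -surjective_pairing reprK.
Qed.

Definition loc_add (x y : loc) : loc :=
  loc_frac (val (repr y).2 * (repr x).1 + val (repr x).2 * (repr y).1)
    (denomM (repr x).2 (repr y).2).
Definition loc_opp (x : loc) : loc := loc_frac (- (repr x).1) (repr x).2.
Definition loc_mul (x y : loc) : loc :=
  loc_frac ((repr x).1 * (repr y).1) (denomM (repr x).2 (repr y).2).
Definition loc_zero : loc := loc_frac 0 denom1.
Definition loc_one : loc := loc_frac 1 denom1.

Lemma loc_frac_repr a s :
  exists2 u : R, u \in S &
    u * (val s * (repr (loc_frac a s)).1 - val (repr (loc_frac a s)).2 * a) = 0.
Proof.
by apply/loc_fracP; rewrite {1}/loc_frac -surjective_pairing reprK.
Qed.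

Lemma loc_addE a s b t :
  loc_add (loc_frac a s) (loc_frac b t) =
  loc_frac (val t * a + val s * b) (denomM s t).
Proof.
have [u Su] := loc_frac_repr a s; have [w Sw] := loc_frac_repr b t.
rewrite /loc_add; case: (repr (loc_frac a s)) => a' s' /=.
case: (repr (loc_frac b t)) => b' t' /= f e; apply/loc_fracP.
exists (u * w); rewrite ?rpredM //=.
move: (sval s) (sval t) (sval s') (sval t') e f => /= {}s {}t {}s' {}t' e f.
transitivity (w * t * t' * (u * (s * a' - s' * a)) +
              u * s * s' * (w * (t * b' - t' * b))); first by ring.
by rewrite e f !mulr0 addr0.
Qed.

Lemma loc_mulE a s b t :
  loc_mul (loc_frac a s) (loc_frac b t) = loc_frac (a * b) (denomM s t).
Proof.
have [u Su] := loc_frac_repr a s; have [w Sw] := loc_frac_repr b t.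
rewrite /loc_mul; case: (repr (loc_frac a s)) => a' s' /=.
case: (repr (loc_frac b t)) => b' t' /= f e; apply/loc_fracP.
exists (u * w); rewrite ?rpredM //=.
move: (sval s) (sval t) (sval s') (sval t') e f => /= {}s {}t {}s' {}t' e f.
transitivity (w * t * b' * (u * (s * a' - s' * a)) +
              u * s' * a * (w * (t * b' - t' * b))); first by ring.
by rewrite e f !mulr0 addr0.
Qed.

Lemma loc_oppE a s : loc_opp (loc_frac a s) = loc_frac (- a) s.
Proof.
have [u Su] := loc_frac_repr a s.
rewrite /loc_opp; case: (repr (loc_frac a s)) => a' s' /= e; apply/loc_fracP.
exists u; rewrite //=; move: (sval s) (sval s') e => /= {}s {}s' e.
transitivity (- (u * (s * a' - s' * a))); first by ring.
by rewrite e oppr0.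
Qed.

Lemma loc_frac_eq a s b t : val t * a = val s * b -> loc_frac a s = loc_frac b t.
Proof.
by move=> e; apply/loc_fracP; exists 1; rewrite ?rpred1 // e subrr mulr0.
Qed.

Fact loc_addA : associative loc_add.
Proof.
move=> x y z; have [a [s ->]] := loc_frac_surj x.
have [b [t ->]] := loc_frac_surj y; have [c [r ->]] := loc_frac_surj z.
by rewrite !loc_addE; apply: loc_frac_eq => /=; ring.
Qed.

Fact loc_addC : commutative loc_add.
Proof.
move=> x y; have [a [s ->]] := loc_frac_surj x.
have [b [t ->]] := loc_frac_surj y.
by rewrite !loc_addE; apply: loc_frac_eq => /=; ring.
Qed.

Fact loc_add0 : left_id loc_zero loc_add.
Proof.
move=> x; have [a [s ->]] := loc_frac_surj x.
by rewrite !loc_addE; apply: loc_frac_eq => /=; ring.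
Qed.

Fact loc_addN : left_inverse loc_zero loc_opp loc_add.
Proof.
move=> x; have [a [s ->]] := loc_frac_surj x.
by rewrite loc_oppE !loc_addE; apply: loc_frac_eq => /=; ring.
Qed.

HB.instance Definition _ :=
  GRing.isZmodule.Build loc loc_addA loc_addC loc_add0 loc_addN.

Fact loc_mulA : associative loc_mul.
Proof.
move=> x y z; have [a [s ->]] := loc_frac_surj x.
have [b [t ->]] := loc_frac_surj y; have [c [r ->]] := loc_frac_surj z.
by rewrite !loc_mulE; apply: loc_frac_eq => /=; ring.
Qed.

Fact loc_mulC : commutative loc_mul.
Proof.
move=> x y; have [a [s ->]] := loc_frac_surj x.
have [b [t ->]] := loc_frac_surj y.
by rewrite !loc_mulE; apply: loc_frac_eq => /=; ring.
Qed.

Fact loc_mul1 : left_id loc_one loc_mul.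
Proof.
move=> x; have [a [s ->]] := loc_frac_surj x.
by rewrite !loc_mulE; apply: loc_frac_eq => /=; ring.
Qed.

Fact loc_mulDl : left_distributive loc_mul loc_add.
Proof.
move=> x y z; have [a [s ->]] := loc_frac_surj x.
have [b [t ->]] := loc_frac_surj y; have [c [r ->]] := loc_frac_surj z.
by rewrite !(loc_mulE, loc_addE); apply: loc_frac_eq => /=; ring.
Qed.

HB.instance Definition _ := GRing.Zmodule_isComPzRing.Build loc
  loc_mulA loc_mulC loc_mul1 loc_mulDl.

Definition loc_map (r : R) : loc := loc_frac r denom1.

Fact loc_map_zmod_morphism : zmod_morphism loc_map.
Proof.
move=> x y; transitivity (loc_add (loc_map x) (loc_opp (loc_map y))) => //.
by rewrite loc_oppE loc_addE; apply: loc_frac_eq => /=; ring.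
Qed.
HB.instance Definition _ :=
  GRing.isZmodMorphism.Build R loc loc_map loc_map_zmod_morphism.

Fact loc_map_monoid_morphism : monoid_morphism loc_map.
Proof.
split=> // x y; transitivity (loc_mul (loc_map x) (loc_map y)) => //.
by rewrite loc_mulE; apply: loc_frac_eq => /=; ring.
Qed.
HB.instance Definition _ :=
  GRing.isMonoidMorphism.Build R loc loc_map loc_map_monoid_morphism.

End Localization.

Arguments loc {R} S.
Arguments loc_frac {R} S a s.
Arguments loc_map {R} S r.

Section TotalRingOfFractions.
Variable R : comPzRingType.

(* In a commutative ring, s is a non-zero-divisor iff it is left regular. *)
Definition nonzerodivisor : {pred R} := [pred s | `[< GRing.lreg s >]].

Fact nonzerodivisor_mulr_closed : mulr_closed nonzerodivisor.
Proof.
split=> [|s t /asboolP hs /asboolP ht]; apply/asboolP; first exact: lreg1.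
exact: lregM.
Qed.
HB.instance Definition _ :=
  GRing.isMulClosed.Build R nonzerodivisor nonzerodivisor_mulr_closed.

Definition total_ring_of_fractions : comPzRingType := loc nonzerodivisor.

Definition balanced : Prop :=
  bijective (loc_map nonzerodivisor : R -> total_ring_of_fractions).

End TotalRingOfFractions.

Section AddPrincipal.
Variables (R : comPzRingType) (M : submodClosed R^o) (s : R).

Definition add_principal : {pred R^o} :=
  [pred x : R^o | `[< exists2 m : R^o, m \in M & exists r : R, x = m + r * s >]].

Fact add_principal_submod_closed : submod_closed add_principal.
Proof.
split=> [|a x y /asboolP [m Mm [r ->]] /asboolP [n Mn [q ->]]]; apply/asboolP.
  by exists 0; [exact: rpred0 | exists 0; rewrite mul0r addr0].
exists (a *: m + n); first by rewrite rpredD ?rpredZ.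
by exists (a * r + q); rewrite /GRing.scale /=; ring.
Qed.
HB.instance Definition _ := GRing.isSubmodClosed.Build R R^o add_principal
  (GRing.submod_closed_semi add_principal_submod_closed).

End AddPrincipal.

Section LocalizationAtMaximal.
Variables (R : comPzRingType) (M : maxIdeal R).

Definition maxIdeal_compl : {pred R} := [pred s : R | (s : R^o) \notin M].

Lemma maxIdeal_inv (s : R) : s \in maxIdeal_compl ->
  exists2 m : R^o, m \in M & exists r : R, 1 = m + r * s.
Proof.
move=> Ms; apply/asboolP; rewrite -[asbool _]/(1 \in add_principal M s).
apply: contraT => J1; case/negP: (Ms : (s : R^o) \notin M).
have [_ Mmax] := maxIdealP M; apply: (Mmax (add_principal M s : submodClosed R^o)) => //.
  by move=> x Mx; apply/asboolP; exists x => //; exists 0; rewrite mul0r addr0.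
by apply/asboolP; exists 0; [exact: rpred0 | exists 1; rewrite mul1r add0r].
Qed.

Fact maxIdeal_compl_mulr_closed : mulr_closed maxIdeal_compl.
Proof.
split=> [|s t Ms Mt]; first by have [] := maxIdealP M.
apply: contra Mt => Mst; have [m Mm [r e]] := maxIdeal_inv Ms.
have -> : t = t *: m + r *: (s * t : R^o) :> R^o.
  by rewrite /GRing.scale /= -{1}[t]mulr1 e; ring.
by apply: rpredD; apply: rpredZ.
Qed.
HB.instance Definition _ :=
  GRing.isMulClosed.Build R maxIdeal_compl maxIdeal_compl_mulr_closed.

Definition loc_at : comPzRingType := loc maxIdeal_compl.

Definition loc_at_ideal : {pred loc_at^o} :=
  [pred x : loc_at^o | `[< exists2 m : R, (m : R^o) \in M &
    exists s, x = loc_frac maxIdeal_compl m s >]].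

Fact loc_at_ideal_submod_closed : submod_closed loc_at_ideal.
Proof.
split=> [|a x y /asboolP [m Mm [s ->]] /asboolP [n Mn [t ->]]]; apply/asboolP.
  by exists 0; [exact: rpred0 | exists (denom1 maxIdeal_compl)].
have [b [r ->]] := loc_frac_surj a.
exists (val t * (b * m) + val (denomM r s) * n).
  apply: (rpredD (_ : _ *: (_ *: (m : R^o)) \in M)
    (_ : _ *: (n : R^o) \in M)); last exact: rpredZ.
  by apply: rpredZ; apply: rpredZ.
exists (denomM (denomM r s) t).
transitivity (loc_add (loc_mul (loc_frac maxIdeal_compl b r)
  (loc_frac maxIdeal_compl m s)) (loc_frac maxIdeal_compl n t)) => //.
by rewrite loc_mulE loc_addE.
Qed.
HB.instance Definition _ := GRing.isSubmodClosed.Build loc_at loc_at^o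
  loc_at_ideal (GRing.submod_closed_semi loc_at_ideal_submod_closed).

Lemma loc_at_ideal_frac m s :
  ((loc_frac maxIdeal_compl m s : loc_at^o) \in loc_at_ideal) =
  ((m : R^o) \in M).
Proof.
apply/asboolP/idP => [[n Mn [t /loc_fracP [u Mu e]]]|Mm]; last first.
  by exists m => //; exists s.
apply: contraT => Mm.
have Mutm : u * val t * m \in maxIdeal_compl.
  by rewrite !rpredM // (valP t).
case/negP: (Mutm : (u * val t * m : R^o) \notin M); have -> : u * val t * m = (u * val s) *: (n : R^o) :> R^o.
  by apply/eqP; rewrite -subr_eq0 /GRing.scale /= -!mulrA -mulrBr; apply/eqP.
exact: rpredZ.
Qed.

Lemma loc_at_unit (x : loc_at) :
  (x : loc_at^o) \notin loc_at_ideal -> exists y : loc_at, y * x = 1.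
Proof.
have [a [s ->]] := loc_frac_surj x; rewrite loc_at_ideal_frac => Ma.
exists (loc_frac maxIdeal_compl (val s) (exist _ a Ma)).
transitivity (loc_mul (loc_frac maxIdeal_compl (val s) (exist _ a Ma))
  (loc_frac maxIdeal_compl a s)) => //.
by rewrite loc_mulE; apply: loc_frac_eq => /=; ring.
Qed.

Fact loc_at_ideal_maximal : maximal_ideal (loc_at_ideal : submodClosed loc_at^o).
Proof.
split; first by rewrite loc_at_ideal_frac; have [] := maxIdealP M.
move=> J J1 _ x Jx; apply: contraT => /loc_at_unit [y e].
by case/negP: J1; rewrite -e; apply: (rpredZ (s := J)).
Qed.

Definition loc_at_maxIdeal : maxIdeal loc_at := MaxIdeal loc_at_ideal_maximal.

Lemma loc_at_local (J : maxIdeal loc_at) : J =i loc_at_maxIdeal.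
Proof.
have [J1 Jmax] := maxIdealP J; have [K1 _] := loc_at_ideal_maximal.
have sJ : {subset J <= (loc_at_ideal : submodClosed loc_at^o)}.
  move=> x Jx; apply: contraT => /loc_at_unit [y e].
  by case/negP: J1; rewrite -e; apply: rpredZ.
by move=> x; apply/idP/idP => [/sJ //|]; apply: Jmax.
Qed.

End LocalizationAtMaximal.

Section Depth.
Variables (A : comPzRingType) (V : lmodType A).

(* (x_1, ..., x_n) V *)
Definition seq_mul (xs : seq A) : {pred V} :=
  [pred v | `[< exists y : 'I_(size xs) -> V, v = \sum_(i < size xs) xs`_i *: y i >]].

Fact seq_mul_submod_closed xs : submod_closed (seq_mul xs).
Proof.
split=> [|a v w /asboolP [y ->] /asboolP [z ->]]; apply/asboolP.
  by exists (fun=> 0); rewrite big1 // => i _; rewrite scaler0.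
exists (fun i => a *: y i + z i); rewrite scaler_sumr -big_split /=.
by apply: eq_bigr => i _; rewrite scalerDr !scalerA mulrC.
Qed.
HB.instance Definition _ xs := GRing.isSubmodClosed.Build A V (seq_mul xs)
  (GRing.submod_closed_semi (seq_mul_submod_closed xs)).

Definition regular_sequence (xs : seq A) : Prop :=
  (forall i, (i < size xs)%N ->
     injective (fun v : quotmod (seq_mul (take i xs)) => xs`_i *: v)) /\
  (exists v : quotmod (seq_mul xs), v != 0).

Definition regular_length (I : {pred A}) (n : nat) : Prop :=
  exists xs : seq A, [/\ {subset xs <= I}, regular_sequence xs & size xs = n].

(* The largest length of a regular sequence in I; [None] stands for infinity. *)
Definition depth (I : {pred A}) : option nat :=
  xget None [set d | exists2 n, d = Some n &
    regular_length I n /\ forall m, regular_length I m -> (m <= n)%N].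

Lemma depthP (I : {pred A}) n :
  depth I = Some n <->
  regular_length I n /\ forall m, regular_length I m -> (m <= n)%N.
Proof.
rewrite /depth; case: xgetP => [d -> [k -> [rk mk]]|none]; split=> //.
- by case=> <-.
- case=> rn mn; congr Some; apply/eqP.
  by rewrite eqn_leq (mn _ rk) (mk _ rn).
- by move=> h; case: (none (Some n)); exists n.
Qed.

End Depth.

Arguments depth {A} V I.

(* Main.v *)
(* Condition (ii) says that each maximal ideal M kills some nonzero z in R.
   Everything rests on one fact: an ideal I of zero-divisors in a Noetherian
   ring kills a nonzero element.  Every zero-divisor lies in a maximal
   annihilator Ann x, which is prime; by finite generation, finitely many x_i
   are enough, in that the intersection of the Ann x_i lies in every maximal
   annihilator.  If I were contained in no Ann x_i, prime avoidance would give
   an element of I outside all of them, hence a non-zero-divisor.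
   R is balanced iff every non-zero-divisor is a unit, so the fact applies to
   the maximal ideals of R; depth R_M = 0 means that M R_M consists of
   zero-divisors, so it applies in R_M, and z moves between R and R_M because
   M is finitely generated. *)
Require Import Defs.
From HB Require Import structures.
From mathcomp Require Import all_boot all_algebra.
From mathcomp Require Import boolp ring.

Set Implicit Arguments.
Unset Strict Implicit.
Unset Printing Implicit Defensive.

Import GRing.Theory.
Local Open Scope ring_scope.

(** * Ideals given by a predicate *)

Section IdealOf.
Variables (R : comPzRingType) (P : R -> Prop).
Hypotheses (P0 : P 0) (PD : forall a x y, P x -> P y -> P (a * x + y)).

(* The proofs are arguments so that the instance below can be inferred. *)
Definition ideal_pred of P 0 & (forall a x y, P x -> P y -> P (a * x + y)) :
  {pred R^o} := [pred x : R^o | `[< P x >]].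

Fact ideal_pred_closed : submod_closed (ideal_pred P0 PD).
Proof.
by split=> [|a x y /asboolP Px /asboolP Py]; apply/asboolP => //; apply: PD.
Qed.
HB.instance Definition _ := GRing.isSubmodClosed.Build R R^o
  (ideal_pred P0 PD) (GRing.submod_closed_semi ideal_pred_closed).

Definition ideal_of : submodClosed R^o := ideal_pred P0 PD.

Lemma ideal_ofP x : reflect (P x) (x \in ideal_of).
Proof. exact: asboolP. Qed.

End IdealOf.

Lemma generator_in (R : pzRingType) (V : lmodType R) (N : submodClosed V)
    n (g : 'I_n -> V) :
  (forall v, v \in N <-> exists c : 'I_n -> R, v = \sum_i c i *: g i) ->
  forall i, g i \in N.
Proof.
move=> gP i; apply/gP; exists (fun j => (j == i)%:R).
rewrite (bigD1 i) //= eqxx scale1r big1 ?addr0 // => j /negPf->.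
by rewrite scale0r.
Qed.

(** * Finiteness conditions in a Noetherian ring *)

Section NoetherianRing.
Variables (R : comPzRingType) (noethR : noetherian R).
Implicit Types (I J K : submodClosed R^o) (x y z a b : R).

Lemma ideal_mulr I a x : (x : R^o) \in I -> (a * x : R^o) \in I.
Proof. exact: rpredZ. Qed.

(** The union of the chain is an ideal, so some stage contains all of its finitely many generators
    and hence the whole union. *)
Lemma noetherian_chain (I : nat -> submodClosed R^o) :
  (forall n, {subset I n <= I n.+1}) ->
  exists n, {subset I n.+1 <= I n}.
Proof.
move=> sI; have sIle m n : (m <= n)%N -> {subset I m <= I n}.
  move/subnK <-; elim: (n - m)%N => [|k IHk] x Ix //.
  by rewrite addSn; apply/sI/IHk.
pose P x := exists n, (x : R^o) \in I n.
have P0 : P 0 by exists 0%N; apply: rpred0.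
have PD a x y : P x -> P y -> P (a * x + y).
  move=> [m Ix] [n Iy]; exists (maxn m n); apply: rpredD.
    by apply/ideal_mulr/(sIle m); rewrite ?leq_maxl.
  by apply/(sIle n); rewrite ?leq_maxr.
have [n [g gP]] := noethR (ideal_of P0 PD).
have /choice[d dP] i : P (g i).
  exact/(ideal_ofP P0 PD)/(generator_in gP).
exists (\max_i d i) => x Ix.
have /(ideal_ofP P0 PD)/gP[c ->] : P x by exists (\max_i d i).+1.
apply: rpred_sum => i _; apply: rpredZ; apply: sIle (dP i).
exact: leq_bigmax.
Qed.

Lemma noetherian_max (F : submodClosed R^o -> Prop) I : F I ->
  exists J, [/\ F J, {subset I <= J} &
    forall K, F K -> {subset J <= K} -> {subset K <= J}].
Proof.
move=> FI; apply: contrapT => noJ.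
(* Membership in [F] is packed into the type, so that [choice] yields a successor function;
   iterating it from [I] gives a strictly increasing chain. *)
pose above := {J | F J /\ {subset I <= J}}.
have grow (J : above) : exists K : above,
    {subset sval J <= sval K} /\ ~ {subset sval K <= sval J}.
  case: J => J [FJ sIJ] /=; apply: contrapT => noK; apply: noJ.
  exists J; split=> // K FK sJK; apply: contrapT => nsKJ; apply: noK.
  have FK' : F K /\ {subset I <= K} by split=> // x /sIJ/sJK.
  by exists (exist _ K FK').
have [next nextP] := choice grow.
have FI' : F I /\ {subset I <= I} by split.
pose c n := sval (iter n next (exist _ I FI' : above)).
have [n|n] := @noetherian_chain c.
  by have [] := nextP (iter n next (exist _ I FI')).
by have [_] := nextP (iter n next (exist _ I FI')).
Qed.

Lemma exists_maxIdeal I : 1 \notin I -> exists M : maxIdeal R, {subset I <= M}.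
Proof.
move=> I1; have [M [M1 sIM Mmax]] := noetherian_max (F := fun J => 1 \notin J) I1.
by exists (MaxIdeal (conj M1 Mmax)).
Qed.

(** The elements killed by all common annihilators of some finite list from [P] form an ideal
    containing [P]; the lists attached to its generators are concatenated. *)
Lemma noetherian_annihilator_finite (P : R -> Prop) :
  exists2 s : seq R, {in s, forall x, P x} &
    forall a, {in s, forall x, a * x = 0} -> forall x, P x -> a * x = 0.
Proof.
pose Q v := exists2 s : seq R, {in s, forall x, P x} &
    forall a, {in s, forall x, a * x = 0} -> a * v = 0.
have Q0 : Q 0 by exists [::] => // a _; rewrite mulr0.
have QD c v w : Q v -> Q w -> Q (c * v + w).
  move=> [s Ps sv] [t Pt tw]; exists (s ++ t) => [x|a ast].
    by rewrite mem_cat => /orP[/Ps|/Pt].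
  rewrite mulrDr mulrCA sv ?tw ?mulr0 ?addr0 // => x xs;
    by apply: ast; rewrite mem_cat xs ?orbT.
have [n [g gP]] := noethR (ideal_of Q0 QD).
have /choice[d dP] i : exists s : seq R, {in s, forall x, P x} /\
    forall a, {in s, forall x, a * x = 0} -> a * g i = 0.
  by have /(ideal_ofP Q0 QD)[s Ps sg] := generator_in gP i; exists s.
exists (flatten [seq d i | i <- enum 'I_n]) => [x /flatten_mapP[i _]|a as0 x Px].
  by have [Pd _] := dP i; apply: Pd.
have /(ideal_ofP Q0 QD)/gP[c ->] : Q x.
  by exists [:: x] => [y|b bx]; [rewrite inE => /eqP-> | apply: bx; rewrite inE].
rewrite mulr_sumr big1 // => i _; rewrite /GRing.scale /= mulrCA.
have [_ ->] := dP i; rewrite ?mulr0 // => y yd; apply: as0.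
by apply/flatten_mapP; exists i; rewrite ?mem_enum.
Qed.

(** * Annihilators maximal among those of nonzero elements *)

Definition max_annihilator x := x <> 0 /\
  forall y, y <> 0 -> (forall a, a * x = 0 -> a * y = 0) ->
    forall a, a * y = 0 -> a * x = 0.

(** If [a * x] is nonzero, its annihilator contains Ann x, hence equals it by maximality, and [b]
    lies in it. *)
Lemma max_annihilator_prime x a b :
  max_annihilator x -> a * b * x = 0 -> a * x = 0 \/ b * x = 0.
Proof.
move=> [_ xmax] abx; have [|/eqP ax] := eqVneq (a * x) 0; [by left | right].
apply: (xmax (a * x)); rewrite // ?mulrA ?[b * a]mulrC // => c cx.
by rewrite mulrCA cx mulr0.
Qed.

Lemma exists_max_annihilator y : y <> 0 ->
  exists2 x, max_annihilator x & forall a, a * y = 0 -> a * x = 0.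
Proof.
have ann0 z : 0 * z = 0 by rewrite mul0r.
have annD z c a b : a * z = 0 -> b * z = 0 -> (c * a + b) * z = 0.
  by move=> az bz; rewrite mulrDl -mulrA az bz mulr0 addr0.
pose ann z := ideal_of (P := fun a => a * z = 0) (ann0 z) (annD z).
have annP z a : reflect (a * z = 0) ((a : R^o) \in ann z).
  exact: (ideal_ofP (P := fun a => a * z = 0)).
move=> y0; have := noetherian_max (F := fun J => exists2 z, z <> 0 & J = ann z).
move=> /(_ (ann y)) [|_ [[x x0 ->] syx xmax]]; first by exists y.
exists x => [|a /annP/syx/annP //]; split=> // z z0 sxz a /annP az.
by apply/annP; apply: (xmax (ann z)) => [|b /annP/sxz/annP|]; first exists z.
Qed.

(* Distinct maximal annihilators are incomparable primes, so Ann x does not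
   contain the intersection of the annihilators of [s]. *)
Lemma max_annihilator_separate (s : seq R) x m :
  max_annihilator x -> {in s, forall y, max_annihilator y} ->
  m * x = 0 -> {in s, forall y, m * y <> 0} ->
  exists2 b, b * x <> 0 & {in s, forall y, b * y = 0}.
Proof.
move=> maxx maxs mx; have [x0 _] := maxx.
elim: s maxs => [|y s IHs] maxs ms; first by exists 1; rewrite ?mul1r.
have [z zs|z zs|b bx bs] := IHs; [exact/maxs/mem_behead|exact/ms/mem_behead|].
have [c cy cx] : exists2 c, c * y = 0 & c * x <> 0.
  have [_ ymax] := maxs y (mem_head y s).
  apply: contrapT => noc; apply: (ms y (mem_head y s)); apply: (ymax x) => //.
  by move=> c cy; apply: contrapT => cx; apply: noc; exists c.
exists (c * b) => [/(max_annihilator_prime maxx)[]//|z].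
by rewrite inE -mulrA => /predU1P[->|/bs->]; rewrite ?mulr0 // mulrCA cy mulr0.
Qed.

Lemma max_annihilator_avoidance I (s : seq R) :
  {in s, forall x, max_annihilator x} ->
  {in s, forall x, exists2 a, (a : R^o) \in I & a * x <> 0} ->
  exists2 m, (m : R^o) \in I & {in s, forall x, m * x <> 0}.
Proof.
elim: s => [|x s IHs] maxs nIs; first by exists 0; rewrite ?rpred0.
have {}IHs : exists2 m, (m : R^o) \in I & {in s, forall y, m * y <> 0}.
  by apply: IHs => y ys; [exact/maxs/mem_behead | exact/nIs/mem_behead].
have [m Im ms] := IHs; have maxx : max_annihilator x by apply: maxs; rewrite mem_head.
have [mx|/eqP mx] := eqVneq (m * x) 0; last first.
  by exists m => // y; rewrite inE => /predU1P[->|/ms].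
have [a Ia ax] := nIs x (mem_head _ _).
have [|b bx bs] := max_annihilator_separate maxx _ mx ms.
  by move=> y ys; exact/maxs/mem_behead.
(* As [b] kills [s], the products with [s] do not change; on [x] only [b * a * x] remains, nonzero
   because Ann x is prime. *)
exists (m + b * a); first by rewrite rpredD // ideal_mulr.
move=> y; rewrite inE mulrDl => /predU1P[->|ys].
  by rewrite mx add0r => /(max_annihilator_prime maxx)[].
by rewrite mulrAC bs // mul0r addr0; apply: ms.
Qed.

Lemma zero_divisor_ideal_annihilated I :
  {in I, forall y, ~ GRing.lreg (y : R)} ->
  exists2 x : R, x <> 0 & forall y : R, (y : R^o) \in I -> y * x = 0.
Proof.
move=> zdI; apply: contrapT => nox.
have [s maxs sann] := noetherian_annihilator_finite max_annihilator.
have [x xs|m Im ms] := max_annihilator_avoidance (I := I) maxs.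
  apply: contrapT => noa; apply: nox; exists x; first by have [] := maxs x xs.
  by move=> y Iy; apply: contrapT => yx; apply: noa; exists y.
(* A nonzero [y] killed by [m] would put [m] in a maximal Ann x; separation then gives [b] killing
   [s] but not [x], against the choice of [s]. *)
apply: (zdI m Im); apply/mulrI0_lreg => y my; apply: contrapT => y0.
have [x maxx yx] := exists_max_annihilator y0.
have [b bx bs] := max_annihilator_separate maxx maxs (yx m my) ms.
exact/bx/sann.
Qed.

End NoetherianRing.

(** * Balanced rings and units *)

Lemma balancedP (R : comPzRingType) :
  balanced R <-> forall s : R, GRing.lreg s -> exists r, r * s = 1.
Proof.
split=> [[g _ gK] s s_reg|inv_reg].
  have sP : s \in @nonzerodivisor R by apply/asboolP.
  (* The preimage of 1/s is the inverse of [s]. *)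
  have := gK (loc_frac (@nonzerodivisor R) 1 (exist _ s sP)).
  rewrite /loc_map; set r := g _ => /loc_fracP[u /asboolP u_reg] /= e.
  exists r; apply/eqP; rewrite -subr_eq0; apply/eqP/u_reg.
  by rewrite mulr0 -e; ring.
have inj : injective (loc_map (@nonzerodivisor R)).
  move=> x y /loc_fracP[u /asboolP u_reg] /=; rewrite !mul1r => e.
  by apply/eqP; rewrite -subr_eq0; apply/eqP/u_reg; rewrite e mulr0.
have /choice[g gK] x : exists r, loc_map (@nonzerodivisor R) r = x.
  have [a [s ->]] := loc_frac_surj x; have /asboolP/inv_reg[r e] := valP s.
  exists (r * a); apply: loc_frac_eq => /=.
  by rewrite mulrA [sval s * r]mulrC e.
by exists g => // x; apply: inj; rewrite gK.
Qed.

(** * Homomorphisms from R/I to R *)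

Section HomQuotient.
Variables (R : comPzRingType) (I : submodClosed R^o).

Section QuotHom.
Variables (z : R) (Iz : forall y : R, (y : R^o) \in I -> y * z = 0).

(** The proof that [I] kills [z] is an argument so that the linear instance below can be
    inferred. *)
Definition quot_hom of (forall y : R, (y : R^o) \in I -> y * z = 0) :=
  fun q : quotmod I => repr q * z : R^o.

Lemma quot_homE (v : R^o) : quot_hom Iz (quotmod_pi I v) = v * z.
Proof.
apply/eqP; rewrite -subr_eq0 -mulrBl Iz //; apply/(@quotmod_piP _ _ I).
by rewrite /quotmod_pi reprK.
Qed.

Fact quot_hom_linear : linear (quot_hom Iz).
Proof.
move=> a q1 q2; have [v ->] := quotmod_pi_surj q1.
have [w ->] := quotmod_pi_surj q2.
rewrite -linearP !quot_homE mulrDl /GRing.scale /=; ring.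
Qed.
HB.instance Definition _ :=
  GRing.isLinear.Build R (quotmod I) R^o _ (quot_hom Iz) quot_hom_linear.
End QuotHom.

(** A map out of R/I is determined by the image of 1, which can be any element killed by [I]. *)
Lemma hom_quot_neq0P :
  (exists f : {linear quotmod I -> R^o}, exists x, f x != 0) <->
  exists2 z : R, z <> 0 & forall y : R, (y : R^o) \in I -> y * z = 0.
Proof.
split=> [[f [q]]|[z z0 Iz]]; last first.
  exists (quot_hom Iz : {linear _ -> _}), (quotmod_pi I 1).
  by rewrite /= quot_homE mul1r; apply/eqP.
have [v ->] := quotmod_pi_surj q.
have fE (w : R) : f (quotmod_pi I w) = w * f (quotmod_pi I 1).
  have {1}-> : w = w *: (1 : R^o) :> R^o by rewrite /GRing.scale /= mulr1.
  by rewrite linearZ linearZ.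
move=> fv; exists (f (quotmod_pi I 1)) => [f1|y Iy].
  by case/eqP: fv; rewrite fE f1 mulr0.
rewrite -fE; suff -> : quotmod_pi I y = 0 by rewrite linear0.
by rewrite -(linear0 (quotmod_pi I)); apply/quotmod_piP; rewrite subr0.
Qed.

End HomQuotient.

(** * Passing between R and its localization at M *)

Section LocalizationAtMaximalIdeal.
Variables (R : comPzRingType) (M : maxIdeal R).
Let S : mulrClosed R := maxIdeal_compl M.

Lemma loc_at_mulE a s b t :
  (loc_frac S a s : loc_at M) * loc_frac S b t = loc_frac S (a * b) (denomM s t).
Proof. exact: loc_mulE. Qed.

Lemma loc_at_frac0 a s :
  (loc_frac S a s : loc_at M) = 0 <-> exists2 u, u \in S & u * a = 0.
Proof.
split=> [/loc_fracP[u Su]|[u Su ua]].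
  by rewrite /= mul1r mulr0 subr0; exists u.
by apply/loc_fracP; exists u => //=; rewrite mul1r mulr0 subr0.
Qed.

(** By clearing denominators, generators of the contraction of [J] to [R] also generate [J]. *)
Lemma noetherian_loc_at : noetherian R -> noetherian (loc_at M).
Proof.
move=> noethR J.
pose P a := (loc_map S a : (loc_at M)^o) \in J.
have P0 : P 0 by rewrite /P raddf0; apply: rpred0.
have PD a x y : P x -> P y -> P (a * x + y).
  move=> Px Py; rewrite /P raddfD /= rmorphM; apply: rpredD => //.
  exact: (rpredZ (s := J)).
have [n [g gP]] := noethR (ideal_of P0 PD).
exists n, (fun i => loc_map S (g i)) => v; split=> [Jv|[c ->]]; last first.
  apply: rpred_sum => i _; apply: rpredZ.
  exact/(ideal_ofP P0 PD)/(generator_in gP).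
have [a [s ev]] := loc_frac_surj v.
have vE : v = (loc_frac S 1 s : loc_at M) * loc_map S a.
  by rewrite ev /loc_map loc_at_mulE; apply: loc_frac_eq => /=; ring.
have /(ideal_ofP P0 PD)/gP[c ac] : P a.
  have -> : P a = ((loc_map S (val s) *: v : (loc_at M)^o) \in J).
    rewrite /P /GRing.scale /= ev /loc_map loc_at_mulE; congr (_ \in J).
    by apply: loc_frac_eq => /=; ring.
  exact: rpredZ.
exists (fun i => (loc_frac S 1 s : loc_at M) * loc_map S (c i)).
rewrite vE ac raddf_sum mulr_sumr; apply: eq_bigr => i _.
by rewrite /GRing.scale /= rmorphM mulrA.
Qed.

Lemma loc_at_1_neq0 : (1 : loc_at M) <> 0.
Proof.
move=> e; have [M1 _] := maxIdealP (loc_at_maxIdeal M).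
by rewrite e rpred0 in M1.
Qed.

Lemma annihilator_loc_at (noethR : noetherian R) :
  (exists2 z : R, z <> 0 & forall y : R, (y : R^o) \in M -> y * z = 0) <->
  (exists2 z : loc_at M, z <> 0 & forall y : loc_at M,
     (y : (loc_at M)^o) \in loc_at_maxIdeal M -> y * z = 0).
Proof.
split=> [[z z0 Mz]|[x]].
  (* If z/1 = 0, some [u] outside [M] kills [z]; so does [M], and together they generate 1. *)
  exists (loc_map S z) => [/loc_at_frac0[u /maxIdeal_inv[m Mm [r e]] uz]|y].
    by apply: z0; rewrite -[z]mul1r e mulrDl Mz // add0r -mulrA uz mulr0.
  have [a [s ->]] := loc_frac_surj y; rewrite [_ \in _]loc_at_ideal_frac => Ma.
  rewrite /loc_map loc_at_mulE; apply/loc_at_frac0; exists 1; first exact: rpred1.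
  by rewrite mul1r; apply: Mz.
have [a [s ->]] := loc_frac_surj x => x0 Mx.
have [n [g gP]] := noethR M.
have /choice[u uP] i : exists u, u \in S /\ u * (g i * a) = 0.
  have := Mx (loc_map S (g i)).
  rewrite [_ \in _]loc_at_ideal_frac => /(_ (generator_in gP i)).
  by rewrite /loc_map loc_at_mulE => /loc_at_frac0[u]; exists u.
(* The factor [u i] kills [g i * a], so the product with [a] is killed by [M]; it is nonzero since
   the [u i] lie outside the prime [M] and a/s is nonzero. *)
exists (\prod_i u i * a) => [ua|y /gP[c ->]].
  apply/x0/loc_at_frac0; exists (\prod_i u i) => //.
  by apply: rpred_prod => i _; have [] := uP i.
rewrite mulr_suml big1 // => i _; rewrite /GRing.scale /= (bigD1 i) //=.
have [_ e] := uP i; transitivity (c i * (\prod_(j | j != i) u j) *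
  (u i * (g i * a))); last by rewrite e mulr0.
by ring.
Qed.

End LocalizationAtMaximalIdeal.

(** * Depth zero and zero-divisors *)

Section DepthZero.
Variables (A : comPzRingType) (m : maxIdeal A).

Lemma seq_mul_nil (V : lmodType A) (v : V) : (v \in seq_mul (V := V) [::]) = (v == 0).
Proof.
apply/asboolP/eqP => [[y ->]|->]; first by rewrite big_ord0.
by exists (fun=> 0); rewrite big_ord0.
Qed.

Lemma quotmod_pi_eq0 (V : lmodType A) (N : submodClosed V) v :
  (quotmod_pi N v == 0) = (v \in N).
Proof.
by rewrite -(linear0 (quotmod_pi N)) -{2}[v]subr0; apply/eqP/quotmod_piP.
Qed.

(** The first regularity condition concerns the quotient by the zero ideal, that is [A] itself. *)
Lemma regular_head_lreg (x : A) (xs : seq A) :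
  @regular_sequence A A^o (x :: xs) -> GRing.lreg x.
Proof.
move=> [/(_ 0%N isT) /= inj _]; apply/mulrI0_lreg => y xy; apply/eqP.
rewrite -(seq_mul_nil (y : A^o)) -quotmod_pi_eq0; apply/eqP/inj => /=.
by rewrite scaler0 -linearZ [_ *: _]xy linear0.
Qed.

Lemma lreg_regular_sequence (x : A) : (x : A^o) \in m -> GRing.lreg x ->
  @regular_sequence A A^o [:: x].
Proof.
move=> mx x_reg; split=> [[|//] _ /= v w|].
  have [a ->] := quotmod_pi_surj v; have [b ->] := quotmod_pi_surj w.
  rewrite -!linearZ => /quotmod_piP; rewrite -scalerBr seq_mul_nil => /eqP xab.
  apply/quotmod_piP; rewrite seq_mul_nil; apply/eqP/x_reg.
  by rewrite mulr0.
exists (quotmod_pi (seq_mul _) (1 : A^o)); rewrite quotmod_pi_eq0; apply/asboolP => -[y].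
rewrite big_ord1 /= => e; have [m1 _] := maxIdealP m; case/negP: m1.
by rewrite e [_ *: _]mulrC; apply: rpredZ.
Qed.

(** The empty sequence is regular because [A] is nonzero; a longer one starts with a
    non-zero-divisor, and any non-zero-divisor in [m] forms one of length 1. *)
Lemma depth0P : (1 : A) <> 0 ->
  depth A^o m = Some 0%N <-> {in m, forall x, ~ GRing.lreg (x : A)}.
Proof.
move=> A1; rewrite depthP; split=> [[_ len0] x mx x_reg|zd].
  have /len0 // : regular_length (A := A) A^o m 1.
  exists [:: x]; split=> //; last exact: lreg_regular_sequence.
  by move=> y; rewrite inE => /eqP->.
split=> [|n [[|x xs] [sm reg <-]]] //.
  exists [::]; split=> //; split=> //.
  exists (quotmod_pi (seq_mul _) (1 : A^o)); rewrite quotmod_pi_eq0 seq_mul_nil; exact/eqP.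
by case: (zd x (sm x (mem_head _ _))); apply: regular_head_lreg reg.
Qed.

Lemma depth0_annihilatorP : noetherian A -> (1 : A) <> 0 ->
  depth A^o m = Some 0%N <->
  exists2 z : A, z <> 0 & forall y : A, (y : A^o) \in m -> y * z = 0.
Proof.
move=> noethA A1; rewrite depth0P //; split=> [|[z z0 mz] y my y_reg].
  exact: zero_divisor_ideal_annihilated.
by apply/z0/y_reg; rewrite mulr0; apply: mz.
Qed.

End DepthZero.

Theorem theorem4p15 (R : comPzRingType) (noethR : noetherian R) :
  (balanced R <->
   forall M : maxIdeal R, exists f : {linear quotmod M -> R^o}, exists x, f x != 0)
  /\
  ((forall M : maxIdeal R, exists f : {linear quotmod M -> R^o}, exists x, f x != 0) <->
   forall M : maxIdeal R, depth (loc_at M)^o (loc_at_maxIdeal M) = Some 0%N).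
Proof.
split; last first.
  (* Both conditions at [M] say that the maximal ideal of the localization kills a nonzero
     element. *)
  have homP (M : maxIdeal R) := iff_trans (hom_quot_neq0P M)
    (annihilator_loc_at M noethR).
  have depthP M := depth0_annihilatorP (loc_at_maxIdeal M)
    (noetherian_loc_at (M := M) noethR) (@loc_at_1_neq0 _ M).
  by split=> annM M; [exact/depthP/homP | exact/homP/depthP].
rewrite balancedP; split=> [inv_reg M|annM s s_reg].
  (* A non-zero-divisor in [M] would be a unit, so [M] consists of zero-divisors. *)
  apply/hom_quot_neq0P/zero_divisor_ideal_annihilated => // y My /inv_reg[r e].
  by have [/negP[]] := maxIdealP M; rewrite -e; apply: ideal_mulr.
(* If [s] is not a unit, its principal ideal lies in some [M], and a nonzero [z] killed by [M]
   contradicts the regularity of [s]. *)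
have P0 : exists r, 0 = r * s by exists 0; rewrite mul0r.
have PD a x y : (exists r, x = r * s) -> (exists r, y = r * s) ->
    exists r, a * x + y = r * s.
  by move=> [r ->] [q ->]; exists (a * r + q); ring.
apply: contrapT => s_inv.
have [|M sM] := exists_maxIdeal noethR (I := ideal_of P0 PD).
  by apply/(ideal_ofP P0 PD) => -[r e]; apply: s_inv; exists r.
have [z z0 Mz] := (hom_quot_neq0P M).1 (annM M).
apply/z0/s_reg; rewrite mulr0; apply/Mz/sM/(ideal_ofP P0 PD).
by exists 1; rewrite mul1r.
Qed.
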